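(* Let $\mathbb{K}\in\{\mathbb{R},\mathbb{C}\}$, let $p,q\in[1,\infty]$, let $\psi$ be a decay rate function with parameter $t^*\ge 0$, let $c_0>0$, and let $\mathcal{E}_p=\mathcal{E}_p(\{\mu_n\}_{n\in\mathbb{N}^*})$ be the infinite-dimensional $p$-ellipsoid over $\mathbb{K}$ with $\psi$-exponentially decaying semi-axes $\mu_n=c_0\exp\{-\ln(2)\,\psi(n)\}$, $n\in\mathbb{N}^*$. Then there exists an integer-valued function $\varepsilon\mapsto d_\varepsilon$ which can be written in the form $$d_\varepsilon=\psi^{(-1)}\left[\log(\varepsilon^{-1})+\log(c_0)\right]+O_{\varepsilon\to0}(1),$$ such that the metric entropy of $\mathcal{E}_p$ satisfies $$H(\varepsilon;\mathcal{E}_p,\|\cdot\|_q)=\sigma_{\mathbb{K}}(d_\varepsilon)\left\{\delta(d_\varepsilon)+\left(\frac1q-\frac1p\right)\log\left(\sigma_{\mathbb{K}}(d_\varepsilon)\right)+O_{d_\varepsilon\to\infty}\left(\zeta(d_\varepsilon)\right)\right\},$$ where $\delta$ and $\zeta$ are the $\psi$-average function and the $\psi$-difference function, respectively.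
   Context: Notation: $\mathbb{N}^*=\{1,2,3,\dots\}$; $\log$ is the logarithm to base $2$, $\ln$ the natural logarithm; $1/\infty=0$. $\sigma_{\mathbb{K}}(d)=d$ if $\mathbb{K}=\mathbb{R}$ and $\sigma_{\mathbb{K}}(d)=2d$ if $\mathbb{K}=\mathbb{C}$. Metric entropy: for a subset $\mathcal{K}$ of a metric space $(\mathcal{X},d)$, an $\varepsilon$-covering is a set $\{x_1,\dots,x_N\}\subseteq\mathcal{X}$ such that every $x\in\mathcal{K}$ has some $i$ with $d(x,x_i)\le\varepsilon$; $N(\varepsilon;\mathcal{K},d)$ is the cardinality of a smallest $\varepsilon$-covering and $H(\varepsilon;\mathcal{K},d)=\log_2N(\varepsilon;\mathcal{K},d)$. $H(\varepsilon;\cdot,\|\cdot\|_q)$ refers to the metric induced by the $\ell^q(\mathbb{N}^*;\mathbb{K})$-norm. Ellipsoid: for a bounded sequence $\{\mu_n\}_{n\in\mathbb{N}^*}$ of non-negative reals (the semi-axes), $\|x\|_{p,\mu}=(\sum_n|x_n/\mu_n|^p)^{1/p}$ if $p<\infty$ and $\|x\|_{\infty,\mu}=\sup_n|x_n/\mu_n|$ (convention $0/0=0$), and $\mathcal{E}_p(\{\mu_n\})=\{x\in\ell^p(\mathbb{N}^*;\mathbb{K}):\|x\|_{p,\mu}\le1\}$. Standing assumption: the semi-axes are in non-increasing order, $\mu_1\ge\mu_2\ge\cdots\ge0$. Decay rate function with parameter $t^*\ge0$: a smooth function $\psi:(0,\infty)\to\mathbb{R}$ with $\psi((t^*,\infty))=(0,\infty)$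 and $t\mapsto\psi(t)/t$ non-decreasing on $(t^*,\infty)$. Such a $\psi$ is strictly increasing on $(t^*,\infty)$; $\psi^{(-1)}:(0,\infty)\to(t^*,\infty)$ denotes the inverse of $\psi|_{(t^*,\infty)}$. $\psi$-average function: $\delta(d)=\frac1d\sum_{n=1}^d(\psi(d)-\psi(n))$ for integers $d\ge1$. $\psi$-difference function: $\zeta(d)=\psi(d)-\psi(d-1)$ for integers $d\ge2$. Here $d_\varepsilon\to\infty$ as $\varepsilon\to0$; $O_{d_\varepsilon\to\infty}(\zeta(d_\varepsilon))$ stands for a quantity bounded in absolute value by a constant (independent of $\varepsilon$) times $\zeta(d_\varepsilon)$ for all sufficiently small $\varepsilon>0$. *)

(* Defs.v *)
From HB Require Import structures.
From mathcomp Require Import all_boot all_order all_algebra.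
From mathcomp Require Import complex.
From mathcomp Require Import all_classical all_reals all_analysis.
Import Order.TTheory GRing.Theory Num.Theory.
Import numFieldNormedType.Exports.

Set Implicit Arguments.
Unset Strict Implicit.
Unset Printing Implicit Defensive.

Local Open Scope classical_set_scope.
Local Open Scope card_scope.
Local Open Scope ring_scope.

Definition log2 (R : realType) (x : R) : R := ln x / ln 2.

Definition log2e (R : realType) (x : \bar R) : \bar R :=
  (lne x * (ln 2)^-1%:E)%E.

Variant base_field := RealField | ComplexField.

Definition field_sort (R : realType) (K : base_field) : numFieldType :=
  match K with RealField => R | ComplexField => R[i]%C end.

Definition modulus (R : realType) (K : base_field) : field_sort R K -> R :=
  match K return field_sort R K -> R with
  | RealField => fun x : R => `|x|
  | ComplexField => fun z : R[i]%C => ComplexField.Normc.normc z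
  end.

Definition sigma (K : base_field) (d : nat) : nat :=
  match K with RealField => d | ComplexField => (2 * d)%N end.

Section Covering.
Context {R : realType} {T : Type}.
Variables (X : set T) (dist : T -> T -> \bar R).

Definition eps_covering (eps : R) (A C : set T) : Prop :=
  C `<=` X /\ forall x, A x -> exists2 y, C y & (dist x y <= eps%:E)%E.

(* +oo when there is no finite covering *)
Definition covering_number (eps : R) (A : set T) : \bar R :=
  ereal_inf [set N%:R%:E | N in
    [set N : nat | exists2 C : set T, C #= `I_N & eps_covering eps A C]].

Definition metric_entropy (eps : R) (A : set T) : \bar R :=
  log2e (covering_number eps A).

End Covering.

(* Sequences over the positive integers are represented as functions on [nat]:
   [x n] is the coordinate of index [n.+1]. *)
Section Sequences.
Context {R : realType} (K : base_field).
Implicit Types (p q : \bar R) (x y : nat -> field_sort R K) (mu : nat -> R).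

Definition lnorm p x : \bar R :=
  ('N[counting]_p [(fun n => (modulus (x n))%:E)])%E.

Definition lspace p : set (nat -> field_sort R K) := [set x | (lnorm p x < +oo)%E].

Definition ldist q x y : \bar R := lnorm q (fun n => x n - y n).

(* The quotient is taken in [\bar R], where [0 / 0 = 0] and [a / 0 = +oo] for
   [0 < a]: a vanishing semi-axis forces the coordinate to vanish. *)
Definition weighted_norm p mu x : \bar R :=
  ('N[counting]_p [(fun n => (modulus (x n))%:E / (mu n)%:E)])%E.

Definition ellipsoid p mu : set (nat -> field_sort R K) :=
  [set x | lspace p x /\ (weighted_norm p mu x <= 1)%E].

End Sequences.

Section DecayRate.
Context {R : realType}.
Implicit Types (psi : R -> R) (tstar c : R).

(* Only the values of [psi] on the positive reals matter. *)
Definition decay_rate_function tstar psi : Prop :=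
  [/\ 0 <= tstar,
      forall (n : nat) (t : R), 0 < t -> derivable (derive1n n psi) t 1,
      psi @` `]tstar, +oo[%classic = `]0, +oo[%classic
    & {in `]tstar, +oo[ &, {homo (fun t => psi t / t) : s t / s <= t}}].

Definition psi_inv tstar psi : R -> R :=
  'pinv_(fun=> 0) `]tstar, +oo[%classic psi.

Definition psi_average psi (d : nat) : R :=
  d%:R^-1 * \sum_(1 <= n < d.+1) (psi d%:R - psi n%:R).

Definition psi_difference psi (d : nat) : R := psi d%:R - psi d.-1%:R.

Definition semi_axes c psi : nat -> R :=
  fun n => c * expR (- (ln 2 * psi n.+1%:R)).

End DecayRate.

(* Main.v *)
Require Import Defs.
From HB Require Import structures.
From mathcomp Require Import all_boot all_order all_algebra.
From mathcomp Require Import complex ring lra.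
From mathcomp Require Import all_classical all_reals all_analysis.
Import Order.TTheory GRing.Theory Num.Theory.
Import numFieldNormedType.Exports.

Set Implicit Arguments.
Unset Strict Implicit.
Unset Printing Implicit Defensive.

Local Open Scope classical_set_scope.
Local Open Scope ring_scope.

(** Write [mu_n] for the semi-axes, [D = sigma(d)] for the number of real
dimensions of the first [d] coordinates, and think of the covering number as
the ratio of the volume of the ellipsoid cut down to these coordinates by the
volume of the [l^q] ball of radius [eps].  Up to a factor [C^D] the unit ball
of [l^p] has volume [D^(-D/p)], so that per real dimension the logarithm of
the ratio is the mean of [log (mu_n / eps)] plus [(1/q - 1/p) log D + O(1)].
When [d] is the first index with [mu_d < eps / A], for a constant [A], the
mean of [log (mu_n / mu_d)] is [delta(d)], and replacing [mu_d] by [eps] costs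
at most one step [zeta(d)] of [psi], plus [log A].
Since [psi(t)/t] is non-decreasing, [psi] grows at least linearly
([decay_rate_linear_growth]).  This has three consequences: [zeta] is bounded
below, so that every [O(1)] is an [O(zeta)]; the constant [A] moves
[psi^(-1)(log (c0 / eps))] by a bounded amount only
([dimension_at_bound]); and the semi-axes decay geometrically
([semi_axes_geometric]).

Volumes are replaced by numbers of points of a grid of mesh
[h = eps / (4 d^(1/q))].

Upper bound ([ellipsoid_covering_le]).  Rounding the first [d] coordinates of
a point of the ellipsoid towards [0] and dropping the others stays in the
ellipsoid; it moves each of the first coordinates by at most
[eps / (2 d^(1/q))], and the dropped tail is at most the sum of the [mu_n]
for [n > d], which is at most [eps / 2] if [A] is large.  So the grid points
of the ellipsoid form a covering.

Lower bound ([ellipsoid_covering_ge]).  The grid points of a box inscribed in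
the ellipsoid have to be covered, and a ball of radius [eps] contains at most
[C^d] of them.

Both counts from above concern [l^1] balls only, because of the inclusions
[d^(-1/p) B_oo <= B_p <= 2 d^(1-1/p) B_1] ([lnorm_le_of_head_tail] and
[lnorm_sum_le]), which lose nothing beyond a factor [C^d] in volume.  In
[l^1], and with arbitrary weights on the coordinates, an exponential moment
bound factorizes over the coordinates and is sharp enough
([chernoff_count]).

In the upper bound [mu_n / eps] is enlarged to [mu_n / mu_d], and one loss
remains ([entropy_bounds]): if [q > p], then
[y_n = (mu_n / mu_d) d^(1/q - 1/p)] may be small for the last coordinates,
while the number of grid points on an axis is at least [1].  The excess
[log (1 + C / y_n)] is at most [C d mu_d / mu_n], and the sum of these over
[n <= d] is [O(d)] by geometric decay.

Sequences are indexed from [0]: in the code [mu n] is the semi-axis of index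
[n + 1], and [mu d.-1] is the last one that is kept. *)

(** * Sequence norms compared with sums and boxes *)

Lemma fine_inv_bounds (R : realType) (p : \bar R) : (1 <= p)%E ->
  0 <= fine p^-1 <= 1.
Proof.
case: p => [r||//] p1; last by rewrite invey/= lexx ler01.
rewrite lee_fin in p1; have r0 : 0 < r by exact: lt_le_trans p1.
by rewrite inver gt_eqF//= invr_ge0 (ltW r0) invf_le1.
Qed.

Lemma powR_inv_exponent_bounds (R : realType) (p : \bar R) d :
  (1 <= p)%E -> (0 < d)%N -> 1 <= (d%:R : R) `^ fine p^-1 <= d%:R.
Proof.
move=> /fine_inv_bounds/andP[p0 p1] d0.
have d1 : 1 <= d%:R :> R by rewrite ler1n.
rewrite -{1}(@powRr0 R d%:R) ler_powR//=.
by rewrite -[leRHS]powRr1 ?ler0n// ler_powR.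
Qed.

(** Only the empty set is negligible for the counting measure, hence the
essential supremum defining the norm for [p = +oo] is a supremum. *)
Lemma near_counting (R : realType) (P : nat -> Prop) :
  (\forall k \ae (@counting nat R), P k) -> forall k, P k.
Proof.
move=> [A [mA A0 PA]] k; apply: contrapT => nPk.
have Ak : A k by exact: PA.
have : (counting [set k] <= (0 : \bar R))%E.
  rewrite -A0; apply: le_measure; rewrite ?inE//.
  by move=> _ ->.
by rewrite /counting asboolT ?fset_set1 ?finmap.cardfs1// lee_fin ler10.
Qed.

Lemma lnorm_leP (R : realType) (r T : R) (a : nat -> R) :
  1 <= r -> 0 < T -> (forall k, 0 <= a k) ->
  ('N[counting]_r%:E [EFin \o a] <= T%:E)%E <->
  (forall m, \sum_(k < m) (a k / T) `^ r <= 1).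
Proof.
move=> r1 T0 a0.
have r0 : 0 < r by exact: lt_le_trans r1.
have Tr0 : 0 < T `^ r by rewrite powR_gt0.
have partE m : (\sum_(0 <= k < m) (`|(EFin \o a) k| `^ r) =
    (T `^ r * \sum_(k < m) (a k / T) `^ r)%:E)%E.
  rewrite big_mkord mulr_sumr -sumEFin; apply: eq_bigr => k _ /=.
  rewrite ger0_norm// -powRM ?divr_ge0 ?(ltW T0)//.
  by rewrite [T * _]mulrC divfK ?gt_eqF.
split => [+ m|sT]; rewrite Lnorm_counting//; first move=> NT.
  have : ((\sum_(0 <= k <oo) `|(EFin \o a) k| `^ r) <= (T `^ r)%:E)%E.
    rewrite -poweR_EFin -[leLHS]poweRe1; last first.
      by apply: nneseries_ge0 => k _ _; exact: poweR_ge0.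
    rewrite -[X in (_ `^ X)%E](mulVf (lt0r_neq0 r0)) poweRrM.
    apply: gt0_ler_poweR NT; first exact: ltW.
    - by rewrite in_itv/= poweR_ge0 leey.
    - by rewrite in_itv/= lee_fin (ltW T0) leey.
  move=> ST; rewrite leNgt; apply/negP => s1; move: ST; apply/negP.
  rewrite -ltNge.
  apply: (@lt_le_trans _ _ (\sum_(0 <= k < m) (`|(EFin \o a) k| `^ r))%E).
    by rewrite partE lte_fin -{1}[T `^ r]mulr1 ltr_pM2l.
  by apply: nneseries_lim_ge => k _ _; exact: poweR_ge0.
have ST : ((\sum_(0 <= k <oo) `|(EFin \o a) k| `^ r) <= (T `^ r)%:E)%E.
  apply: lime_le.
    by apply: is_cvg_nneseries => k _ _; exact: poweR_ge0.
  apply: nearW => m; rewrite partE lee_fin -{2}[T `^ r]mulr1.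
  by rewrite ler_pM2l.
have -> : T%:E = ((T `^ r)%:E `^ r^-1)%E.
  by rewrite poweR_EFin -powRrM mulfV ?gt_eqF// powRr1// ltW.
apply: gt0_ler_poweR ST; first by rewrite ltW ?invr_gt0.
- rewrite in_itv/= leey andbT.
  by apply: nneseries_ge0 => k _ _; rewrite lee_fin powR_ge0.
- by rewrite in_itv/= lee_fin (ltW Tr0) leey.
Qed.

Lemma lnormy_leP (R : realType) (T : R) (a : nat -> R) :
  (forall k, 0 <= a k) ->
  ('N[counting]_+oo%E [EFin \o a] <= T%:E)%E <-> (forall k, a k <= T).
Proof.
move=> a0; rewrite unlock.
have -> : (0 < (@counting nat R) setT)%E.
  by rewrite /counting asboolF ?ltry//; exact: infinite_nat.
split => [/ess_sup_inf.ess_supP/near_counting aT k|aT].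
  by have := aT k; rewrite /= ger0_norm.
apply/ess_sup_inf.ess_supP; apply: nearW => k /=.
by rewrite ger0_norm// lee_fin.
Qed.

(** A substitute for Hoelder's inequality: summed over [d] normalized
coordinates, it compares an [l^1] norm with an [l^r] norm up to a factor [2]. *)
Lemma le1Dpow (R : realType) (u r : R) : 0 <= u -> 1 <= r -> u <= 1 + u `^ r.
Proof.
move=> u0 r1; have [u1|u1] := leP u 1.
  by rewrite (le_trans u1)// lerDl powR_ge0.
by rewrite (le_trans (le1r_powR (ltW u1) r1))// lerDr.
Qed.

Lemma powR_le_id (R : realType) (u r : R) :
  0 <= u -> u <= 1 -> 1 <= r -> u `^ r <= u.
Proof.
move=> u0 u1 r1; move: u0; rewrite le_eqVlt => /predU1P[<-|u0].
  by rewrite powR0// gt_eqF// (lt_le_trans _ r1).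
by rewrite -[leRHS]powRr1 ?(ltW u0)//; apply: ger_powR => //; rewrite u0.
Qed.

Lemma lnorm_coord_le (R : realType) (p : \bar R) (T : R) (a : nat -> R) n :
  (1 <= p)%E -> 0 < T -> (forall k, 0 <= a k) ->
  ('N[counting]_p [EFin \o a] <= T%:E)%E -> a n <= T.
Proof.
case: p => [r||//] p1 T0 a0; last by move/(lnormy_leP T a0).
move/(lnorm_leP p1 T0 a0)/(_ n.+1); rewrite big_ord_recr/= => S1.
rewrite -[leRHS]mul1r -ler_pdivrMr// leNgt; apply/negP => an.
have := le1r_powR (ltW an) p1; apply/negP; rewrite -ltNge (le_lt_trans _ an)//.
by rewrite (le_trans _ S1)// lerDr sumr_ge0// => i _; exact: powR_ge0.
Qed.

(** The inclusion of the [l^p] ball in [2 d^(1-1/p)] times the [l^1] ball, in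
dimension [d]. *)
Lemma lnorm_sum_le (R : realType) (p : \bar R) (T : R) (a : nat -> R) d :
  (1 <= p)%E -> 0 < T -> (0 < d)%N -> (forall k, 0 <= a k) ->
  ('N[counting]_p [EFin \o a] <= T%:E)%E ->
  \sum_(n < d) a n <= 2 * T * d%:R / d%:R `^ fine p^-1.
Proof.
move=> p1 T0 d0 a0 aT; have dR : 0 < d%:R :> R by rewrite ltr0n.
have G0 : 0 < (d%:R : R) `^ fine p^-1 by rewrite powR_gt0.
rewrite ler_pdivlMr//; case: p p1 aT G0 => [r||//] p1 aT G0; last first.
  rewrite invey/= powRr0 mulr1.
  apply: (@le_trans _ _ (\sum_(n < d) T)).
    by apply: ler_sum => n _; apply: (lnormy_leP T a0).1.
  rewrite sumr_const card_ord -[T *+ d]mulr_natr -mulrA ler_peMl ?ler1n//.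
  by rewrite mulr_ge0// ltW.
rewrite lee_fin in p1; have r0 : 0 < r by rewrite (lt_le_trans _ p1).
move: G0; rewrite inver gt_eqF//= => G0.
have -> : (\sum_(n < d) a n) * d%:R `^ r^-1 =
    T * \sum_(n < d) (a n / T * d%:R `^ r^-1).
  rewrite mulr_suml mulr_sumr; apply: eq_bigr => n _.
  by rewrite mulrA [T * _]mulrC divfK// gt_eqF.
rewrite [2 * T]mulrC -mulrA ler_pM2l//.
apply: (@le_trans _ _ (\sum_(n < d) (1 + (a n / T) `^ r * d%:R))).
  apply: ler_sum => n _.
  have u0 : 0 <= a n / T * d%:R `^ r^-1.
    by rewrite mulr_ge0 ?divr_ge0 ?a0 ?(ltW T0)// ltW.
  rewrite (le_trans (le1Dpow u0 p1))// lerD2l powRM ?divr_ge0 ?a0 ?(ltW T0) ?(ltW G0)//.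
  by rewrite -powRrM mulVf ?gt_eqF// powRr1 ?ler0n.
rewrite big_split/= sumr_const card_ord -mulr_suml mulrDl !mul1r lerD2l.
by rewrite ler_piMl ?ler0n//; exact: (lnorm_leP p1 T0 a0).1.
Qed.

(** A box of side about [d^(-1/p)] lies in the [l^p] ball, and there is room left
for a tail that is small in [l^1]: each of the two parts contributes at most
[1/2] to the sum of the [r]-th powers of the entries divided by [T]. *)
Lemma lnorm_le_of_head_tail (R : realType) (p : \bar R) (T : R) (a : nat -> R) d :
  (1 <= p)%E -> 0 < T -> (0 < d)%N -> (forall k, 0 <= a k) ->
  (forall n, (n < d)%N -> a n <= T / (2 * d%:R `^ fine p^-1)) ->
  (forall m, \sum_(d <= n < m) a n <= T / 2) ->
  ('N[counting]_p [EFin \o a] <= T%:E)%E.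
Proof.
move=> p1 T0 d0 a0 hd tl; have dR : 0 < d%:R :> R by rewrite ltr0n.
have d1 : 1 <= d%:R :> R by rewrite ler1n.
have tl1 n : (d <= n)%N -> a n <= T / 2.
  move=> dn; apply: le_trans (tl n.+1); rewrite big_nat_recr//= lerDr.
  by rewrite sumr_ge0.
have T2 : T / 2 <= T by lra.
case: p p1 hd => [r||//] p1 hd; last first.
  apply/lnormy_leP => // k; have [kd|dk] := ltnP k d.
    by rewrite (le_trans (hd _ kd))// invey/= powRr0 mulr1.
  exact: le_trans (tl1 _ dk) T2.
rewrite lee_fin in p1; have r0 : 0 < r by rewrite (lt_le_trans _ p1).
move: hd; rewrite inver gt_eqF//= => hd.
(* Head entries contribute 1 / (2 d) each; a tail entry is at most T, so that
   its r-th power is at most the entry itself. *)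
pose b k := if (k < d)%N then (2 * d%:R)^-1 else a k / T.
have b0 k : 0 <= b k.
  rewrite /b; case: ifP => _; first by rewrite invr_ge0 mulr_ge0.
  by rewrite divr_ge0// ltW.
have ab k : (a k / T) `^ r <= b k.
  rewrite /b; case: ltnP => kd.
    have G0 : 0 < (d%:R : R) `^ r^-1 by rewrite powR_gt0.
    apply: (@le_trans _ _ ((2 * d%:R `^ r^-1)^-1 `^ r)).
      apply: ge0_ler_powR; first exact: ltW.
      - by rewrite nnegrE divr_ge0// ltW.
      - by rewrite nnegrE invr_ge0 mulr_ge0// ltW.
      by rewrite ler_pdivrMr// mulrC hd.
    rewrite -powR_inv1 ?mulr_ge0 ?(ltW G0)// -powRrM mulN1r powRN.
    rewrite lef_pV2 ?posrE ?mulr_gt0 ?powR_gt0//; last by rewrite mulr_gt0.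
    rewrite powRM ?(ltW G0)// -powRrM mulVf ?gt_eqF// powRr1 ?(ltW dR)//.
    by rewrite ler_pM2r// le1r_powR// ler1n.
  apply: powR_le_id => //; first by rewrite divr_ge0// ltW.
  by rewrite ler_pdivrMr// mul1r (le_trans (tl1 _ kd)).
apply/lnorm_leP => // m.
(* Going up to m + d ensures that the whole head is present. *)
apply: (@le_trans _ _ (\sum_(0 <= k < m + d) b k)).
  rewrite (@big_cat_nat _ _ _ m)//= ?leq_addr// big_mkord.
  rewrite -[leLHS]addr0 lerD ?ler_sum ?sumr_ge0//.
rewrite (@big_cat_nat _ _ _ d)//= ?leq_addl//.
have -> : \sum_(0 <= i < d) b i = 2^-1.
  rewrite big_mkord (eq_bigr (fun=> (2 * d%:R)^-1)) => [|i _].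
    rewrite sumr_const card_ord -[LHS]mulr_natl invfM mulrCA divff ?mulr1//.
    by rewrite gt_eqF.
  by rewrite /b ltn_ord.
rewrite big_nat_cond (eq_bigr (fun k => a k / T)) => [|i].
  rewrite -big_nat_cond -mulr_suml.
  have : (\sum_(d <= i < m + d) a i) / T <= 2^-1.
    by rewrite ler_pdivrMr// mulrC tl.
  lra.
by rewrite /b andbT => /andP[di _]; rewrite ltnNge di.
Qed.

(** * Counting points of a cubic grid *)

(** Each counted [f] contributes at least [1] to the sum over all [f] of
[expR (T - \sum_i a i (f i))], and this sum factorizes over [I]. *)
Lemma chernoff_count (R : realType) (I B : finType) (a : I -> B -> R) (T : R) :
  #|[pred f : {ffun I -> B} | \sum_i a i (f i) <= T]|%:R
    <= expR T * \prod_i \sum_b expR (- a i b).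
Proof.
rewrite bigA_distr_bigA/= mulr_sumr -sumr_const.
rewrite [leRHS](bigID (mem [pred f : {ffun I -> B} | \sum_i a i (f i) <= T]))/=.
rewrite -[leLHS]addr0 lerD//; last first.
  by apply: sumr_ge0 => f _; rewrite mulr_ge0 ?expR_ge0// prodr_ge0.
apply: ler_sum => f; rewrite inE => fT.
by rewrite -expR_sum -expRD -expR0 ler_expR sumrN subr_ge0.
Qed.

Lemma sum_geometric_le (R : realType) (x : R) m : 0 <= x -> x < 1 ->
  \sum_(0 <= j < m) x ^+ j <= (1 - x)^-1.
Proof.
move=> x0 x1; have x1' : 0 < 1 - x by rewrite subr_gt0.
rewrite -[leRHS]mul1r ler_pdivlMr// mulrC big_mkord -opprB mulNr -subrX1 opprB.
by rewrite lerBlDr lerDl exprn_ge0.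
Qed.

(** Two geometric series, one on each side of [b0], of ratio [x = expR (- s^-1)],
for which [1 / (1 - x) <= 1 + s]. *)
Lemma sum_exp_dist_le (R : realType) (s : R) n (b0 : nat) : 0 < s ->
  \sum_(b < n) expR (- (`|b%:R - b0%:R| / s)) <= 2 * (1 + s).
Proof.
move=> s0; pose x := expR (- s^-1).
have x0 : 0 <= x by exact: expR_ge0.
have x1 : x < 1 by rewrite -expR0 ltr_expR oppr_lt0 invr_gt0.
have geo m : \sum_(0 <= j < m) x ^+ j <= 1 + s.
  rewrite (le_trans (sum_geometric_le _ x0 x1))//.
  have xs : x * (1 + s) <= s.
    have -> : 1 + s = (1 + s^-1) * s by rewrite mulrDl mulVf ?gt_eqF// mul1r addrC.
    rewrite mulrA -[leRHS]mul1r ler_pM2r//.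
    apply: (@le_trans _ _ (x * expR s^-1)).
      by rewrite ler_wpM2l// expR_ge1Dx.
    by rewrite -expRD addNr expR0.
  rewrite -div1r ler_pdivrMr ?subr_gt0//; lra.
have expE k : expR (- (k%:R / s)) = x ^+ k.
  by rewrite -mulrN expRM_natl.
rewrite -(big_mkord xpredT (fun b => expR (- (`|b%:R - b0%:R| / s)))).
apply: (@le_trans _ _ (\sum_(0 <= b < b0 + n) expR (- (`|b%:R - b0%:R| / s)))).
  by rewrite [leRHS](@big_cat_nat _ _ _ n)//= ?leq_addl// lerDl sumr_ge0.
rewrite (@big_cat_nat _ _ _ b0)//= ?leq_addr// mulrDl mul1r lerD//.
  rewrite big_nat_rev/= (le_trans _ (geo b0))//.
  rewrite big_nat [leRHS]big_nat; apply: ler_sum => i /andP[_ ib0].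
  rewrite add0n -normrN opprB -natrB ?leq_subr// normr_nat expE subKn//.
  by rewrite exprS ler_piMl ?exprn_ge0// ltW.
rewrite -{1}[b0]add0n big_addn addnC addnK (le_trans _ (geo n))//.
apply: ler_sum => i _.
by rewrite natrD addrK normr_nat expE.
Qed.

Lemma modulus_ge0 (R : realType) K (x : field_sort R K) : 0 <= modulus x.
Proof. by case: K x => [x|[a b]] /=; rewrite ?normr_ge0 ?sqrtr_ge0. Qed.

Lemma modulus0 (R : realType) K : modulus (0 : field_sort R K) = 0.
Proof. by case: K; [exact: normr0 | exact: ComplexField.Normc.normc0]. Qed.

Lemma modulusD (R : realType) K (x y : field_sort R K) :
  modulus (x + y) <= modulus x + modulus y.
Proof. by case: K x y => x y; [exact: ler_normD | exact: le_normcD]. Qed.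

Lemma modulusN (R : realType) K (x : field_sort R K) : modulus (- x) = modulus x.
Proof. by case: K x => x; [exact: normrN | exact: normcN]. Qed.

(** Together with [sum_le_normc], this reduces moduli of complex numbers to
absolute values of their two coordinates, up to a factor [2]. *)
Lemma normc_le_sum (R : realType) (z : R[i]%C) :
  ComplexField.Normc.normc z <= `|complex.Re z| + `|complex.Im z|.
Proof.
case: z => a b /=; rewrite -ler_sqr ?nnegrE ?sqrtr_ge0 ?addr_ge0//.
rewrite sqr_sqrtr ?addr_ge0 ?sqr_ge0// sqrrD !real_normK ?num_real//.
by rewrite lerD2r lerDl mulrn_wge0// mulr_ge0.
Qed.

Lemma sum_le_normc (R : realType) (z : R[i]%C) :
  (`|complex.Re z| <= ComplexField.Normc.normc z) /\
  (`|complex.Im z| <= ComplexField.Normc.normc z).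
Proof.
case: z => a b /=; rewrite -!sqrtr_sqr !ler_sqrt ?addr_ge0 ?sqr_ge0//.
by rewrite lerDl lerDr !sqr_ge0.
Qed.

(** The grid of mesh [h] is truncated to the square of half-side [M h]: being a
finite type, it gives finitely supported grid sequences as finite functions.
The index [M] stands for the origin. *)
Definition grid_index (K : base_field) (M : nat) : finType :=
  match K with
  | RealField => 'I_(2 * M).+1
  | ComplexField => ('I_(2 * M).+1 * 'I_(2 * M).+1)%type
  end.

Definition grid_coord (R : realType) (M : nat) (h : R) (b : 'I_(2 * M).+1) : R :=
  h * (b%:R - M%:R).

Definition grid_point (R : realType) (K : base_field) (M : nat) (h : R) :
    grid_index K M -> field_sort R K :=
  match K return grid_index K M -> field_sort R K with
  | RealField => fun b => grid_coord h b
  | ComplexField => fun b =>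
     Complex (grid_coord h b.1) (grid_coord h b.2)
  end.

Lemma sum_exp_coord_le (R : realType) M (h s : R) (b0 : 'I_(2 * M).+1) :
  0 < h -> 0 < s ->
  \sum_(b < (2 * M).+1) expR (- (`|grid_coord h b - grid_coord h b0| / s))
    <= 2 * (1 + s / h).
Proof.
move=> h0 s0; have sh : 0 < s / h by rewrite divr_gt0.
apply: le_trans (sum_exp_dist_le (2 * M).+1 b0 sh).
apply: ler_sum => b _; rewrite ler_expR lerN2 /grid_coord -mulrBr.
rewrite opprB addrA subrK normrM (gtr0_norm h0) invf_div.
by rewrite mulrA [_ * h]mulrC.
Qed.

(** The exponential moments to which [chernoff_count] is applied.  The bound is
uniform in the centre [b0], because the lower bound on the covering number
uses it around an arbitrary grid point. *)
Lemma sum_exp_grid_le (R : realType) K M (h s : R) (b0 : grid_index K M) :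
  0 < h -> 0 < s ->
  \sum_(b : grid_index K M) expR (- (modulus (grid_point h b - grid_point h b0) / s))
    <= (2 + 4 * (s / h)) ^+ sigma K 1.
Proof.
move=> h0 s0; have sh : 0 < s / h by rewrite divr_gt0.
case: K b0 => b0 /=.
  by rewrite expr1 (le_trans (sum_exp_coord_le _ h0 s0))//; lra.
rewrite expr2.
pose F (b0 b : 'I_(2 * M).+1) :=
  expR (- (`|grid_coord h b - grid_coord h b0| / (2 * s))).
apply: (@le_trans _ _ (\sum_b (F b0.1 b.1 * F b0.2 b.2))).
  apply: ler_sum => b _; rewrite /F -expRD ler_expR -opprD lerN2 -mulrDl.
  rewrite invfM mulrA ler_pM2r ?invr_gt0// ler_pdivrMr//.
  have [z1 z2] := sum_le_normc (@grid_point R ComplexField M h b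
    - @grid_point R ComplexField M h b0).
  by rewrite mulr_natr mulr2n lerD.
rewrite -(pair_bigA _ (fun i j => F b0.1 i * F b0.2 j))/=.
rewrite -big_distrlr/=.
have S b : \sum_j F b j <= 2 + 4 * (s / h).
  rewrite (le_trans (sum_exp_coord_le _ h0 _))//; first by rewrite mulr_gt0.
  by rewrite -mulrA; lra.
by apply: ler_pM => //; apply: sumr_ge0 => j _; exact: expR_ge0.
Qed.

Lemma grid_coord_round (R : realType) M (h x : R) : 0 < h -> `|x| <= M%:R * h ->
  exists b : 'I_(2 * M).+1,
    `|grid_coord h b| <= `|x| /\ `|x - grid_coord h b| <= h.
Proof.
move=> h0 xM; pose m := Num.truncn (`|x| / h).
have /andP[m1 m2] : m%:R <= `|x| / h < m.+1%:R.
  by apply: truncn_itv; rewrite divr_ge0// ltW.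
rewrite ler_pdivlMr// in m1; rewrite ltr_pdivrMr// in m2.
have mM : (m <= M)%N.
  by rewrite -(@ler_nat R) -(ler_pM2r h0) (le_trans m1).
have [x0|x0] := leP 0 x.
  have bP : (M + m < (2 * M).+1)%N by rewrite ltnS mul2n -addnn leq_add2l.
  exists (Ordinal bP); rewrite /grid_coord/= natrD addrC addKr.
  move: m1 m2; rewrite (ger0_norm x0) -natr1 mulrDl mul1r => m1 m2.
  rewrite !ger0_norm ?mulr_ge0 ?(ltW h0)//; last by rewrite subr_ge0 mulrC.
  by split; lra.
have bP : (M - m < (2 * M).+1)%N.
  by rewrite ltnS mul2n -addnn (leq_trans (leq_subr _ _))// leq_addr.
exists (Ordinal bP); rewrite /grid_coord/= natrB// addrC addKr mulrN.
move: m1 m2; rewrite (ltr0_norm x0) -natr1 mulrDl mul1r opprK normrN => m1 m2.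
rewrite ger0_norm ?mulr_ge0 ?(ltW h0)// ler0_norm; last by lra.
by split; lra.
Qed.

(** Rounding goes towards [0], so that the modulus does not increase; this keeps
rounded points in the ellipsoid. *)
Lemma grid_round (R : realType) K M (h : R) (x : field_sort R K) :
  0 < h -> modulus x <= M%:R * h ->
  exists b : grid_index K M, modulus (grid_point h b) <= modulus x /\
    modulus (x - grid_point h b) <= 2 * h.
Proof.
move=> h0; case: K x => [x|[x y]] /= xM.
  have [b [b1 b2]] := grid_coord_round h0 xM.
  by exists b; split=> //; rewrite (le_trans b2)//; lra.
have [/= xr yr] := sum_le_normc (Complex x y).
have [b [b1 b2]] := grid_coord_round h0 (le_trans xr xM).
have [c [c1 c2]] := grid_coord_round h0 (le_trans yr xM).
exists (b, c); split => /=.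
  rewrite ler_sqrt ?addr_ge0 ?sqr_ge0// -[x ^+ 2]real_normK ?num_real//.
  rewrite -[y ^+ 2]real_normK ?num_real// -[grid_coord h b ^+ 2]real_normK ?num_real//.
  rewrite -[grid_coord h c ^+ 2]real_normK ?num_real//.
  by rewrite lerD// ler_sqr ?nnegrE.
rewrite (le_trans (normc_le_sum (Complex _ _)))//= mulrDl mul1r lerD//.
Qed.

Lemma card_coord_ge (R : realType) M (h y : R) : 0 < h -> 0 <= y ->
  y <= M%:R * h ->
  y / h <= #|[pred b : 'I_(2 * M).+1 | `|grid_coord h b| <= y]|%:R.
Proof.
move=> h0 y0 yM; pose m := Num.truncn (y / h).
have /andP[m1 m2] : m%:R <= y / h < m.+1%:R.
  by apply: truncn_itv; rewrite divr_ge0// ltW.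
rewrite ler_pdivlMr// in m1.
have mM : (m <= M)%N.
  by rewrite -(@ler_nat R) -(ler_pM2r h0) (le_trans m1).
rewrite (le_trans (ltW m2))// ler_nat.
have bP (j : 'I_m.+1) : (M + j < (2 * M).+1)%N.
  by rewrite ltnS mul2n -addnn leq_add2l (leq_trans _ mM)// -ltnS.
pose f j := Ordinal (bP j).
have f_inj : injective f.
  by move=> i j /(congr1 val)/= /addnI ij; apply: val_inj.
rewrite -[m.+1]card_ord -(fintype.card_image f_inj); apply: fintype.subset_leq_card.
apply/fintype.subsetP => _ /fintype.imageP[j _ ->]; rewrite inE /grid_coord/= natrD addrC addKr.
rewrite ger0_norm ?mulr_ge0 ?(ltW h0)// mulrC (le_trans _ m1)//.
by rewrite ler_pM2r// ler_nat -ltnS.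
Qed.

Lemma card_grid_ge (R : realType) K M (h y : R) : 0 < h -> 0 <= y ->
  y <= M%:R * h ->
  (y / (2 * h)) ^+ sigma K 1 <=
    #|[pred b : grid_index K M | modulus (grid_point h b) <= y]|%:R.
Proof.
move=> h0 y0 yM; have y2 : 0 <= y / 2 by rewrite divr_ge0.
have C := card_coord_ge h0 y2 (le_trans (_ : y / 2 <= y) yM).
case: K => /=.
  rewrite expr1 (le_trans _ (card_coord_ge h0 y0 yM))//.
  by rewrite ler_wpM2l// lef_pV2 ?posrE; lra.
have -> : y / (2 * h) = y / 2 / h by rewrite invfM mulrA.
set A := [pred b | _] in C.
apply: (@le_trans _ _ (#|A| * #|A|)%:R).
  by rewrite expr2 natrM ler_pM ?C// ?divr_ge0 ?(ltW h0)//; lra.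
rewrite ler_nat -cardX; apply: fintype.subset_leq_card.
apply/fintype.subsetP => -[b c]; rewrite !inE/= => /andP[b1 c1].
rewrite (le_trans (normc_le_sum (Complex _ _)))//=.
by rewrite [leRHS]splitr lerD.
Qed.

(** * Bounding covering numbers by counting *)

Lemma covering_number_le (R : realType) (T : Type) (X A : set T)
    (dist : T -> T -> \bar R) (eps : R) (F : finType) (P : pred F) (g : F -> T) :
  (forall f, P f -> X (g f)) ->
  (forall x, A x -> exists2 f, P f & (dist x (g f) <= eps%:E)%E) ->
  (covering_number X dist eps A <= #|P|%:R%:E)%E.
Proof.
move=> gX cov; pose C := range (fun i : 'I_#|P| => g (enum_val i)).
have CP : (C #<= `I_#|P|)%card.
  by rewrite (card_le_eqr card_II); exact: card_image_le.
have [n Cn] : finite_set C by exact: card_le_finite CP (finite_II _).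
have nP : (n <= #|P|)%N by rewrite -card_le_II -(card_le_eql Cn).
apply: (@le_trans _ _ n%:R%:E); last by rewrite lee_fin ler_nat.
apply: ereal_inf_lbound; exists n => //; exists C => //; split.
  by move=> _ [i _ <-]; apply: gX; have := enum_valP i.
move=> x /cov[f Pf xf]; exists (g f) => //; exists (enum_rank_in Pf f) => //.
by rewrite enum_rankK_in.
Qed.

(** Send each point of the family to a covering centre at distance at most [eps]:
the fibres of this map have at most [m] elements. *)
Lemma covering_number_ge (R : realType) (T : Type) (X A : set T)
    (dist : T -> T -> \bar R) (eps m : R) (F : finType) (P : pred F) (g : F -> T) :
  (forall f, P f -> A (g f)) -> 0 < m ->
  (forall y, #|[pred f | P f && `[< (dist (g f) y <= eps%:E)%E >]]|%:R <= m) ->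
  ((#|P|%:R / m)%:E <= covering_number X dist eps A)%E.
Proof.
move=> gA m0 fib; apply/ereal_infP => _ [N [C CN [CX cov]] <-].
rewrite lee_fin ler_pdivrMr//.
(* y f is a centre close to g f; idx then numbers the centres by 'I_N. *)
have /choice[y yP] f : exists y, P f -> C y /\ (dist (g f) y <= eps%:E)%E.
  have [Pf|nPf] := boolP (P f); last by exists (g f).
  by have [y Cy ?] := cov _ (gA _ Pf); exists y.
have /card_set_bijP[idx [idxN idx_inj _]] := CN.
rewrite -sum1_card natr_sum.
rewrite (eq_bigr (fun f => \sum_(j < N) (idx (y f) == j)%:R)) => [|f Pf]; last first.
  have fN : (idx (y f) < N)%N by exact: idxN (yP f Pf).1.
  rewrite (bigD1 (Ordinal fN))//= eqxx big1 ?addr0// => j.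
  by rewrite -val_eqE/= eq_sym => /negPf ->.
rewrite exchange_big/= -[N in leRHS]card_ord mulr_natl -sumr_const.
apply: ler_sum => j _.
have [[f0 [Pf0 f0j]]|noP] :=
    pselect (exists f, P f /\ idx (y f) = j); last first.
  rewrite big1 ?(ltW m0)// => f Pf; case: eqP => // fj.
  by case: noP; exists f.
apply: le_trans (fib (y f0)); rewrite -natr_sum -big_mkcondr/= sum1_card ler_nat.
apply/fintype.subset_leq_card/fintype.subsetP => f; rewrite !inE.
move=> /andP[Pf /eqP fj]; rewrite [P f]Pf/=; apply/asboolP.
have [Cf ff] := yP f Pf; have [Cf0 _] := yP f0 Pf0.
suff <- : y f = y f0 by [].
by apply: idx_inj; rewrite ?inE// fj f0j.
Qed.

Lemma metric_entropy_between (R : realType) (T : Type) (X A : set T)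
    (dist : T -> T -> \bar R) (eps a b : R) : 0 < a ->
  (a%:E <= covering_number X dist eps A)%E ->
  (covering_number X dist eps A <= b%:E)%E ->
  exists2 H, metric_entropy X dist eps A = H%:E & ln a <= H * ln 2 <= ln b.
Proof.
move=> a0; rewrite /metric_entropy; case: covering_number => [c| |]//.
rewrite !lee_fin => ac cb; have c0 : 0 < c by exact: lt_le_trans ac.
exists (ln c / ln 2); first by rewrite /log2e lne_EFin.
have b0 : 0 < b by exact: lt_le_trans cb.
by rewrite divfK ?gt_eqF ?ln_gt0 ?ltr1n// !ler_ln ?posrE// ac.
Qed.

(** * Entropy of an ellipsoid in terms of its first semi-axes *)

Lemma grid_zero (R : realType) K M (h : R) :
  exists b0 : grid_index K M, grid_point h b0 = 0.
Proof.
have bP : (M < (2 * M).+1)%N by rewrite ltnS mul2n -addnn leq_addr.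
have c0 : grid_coord h (Ordinal bP) = 0 by rewrite /grid_coord subrr mulr0.
case: K; first by exists (Ordinal bP).
by exists (Ordinal bP, Ordinal bP); rewrite /grid_point/= c0.
Qed.

Lemma weighted_normE (R : realType) K (p : \bar R) (mu : nat -> R)
    (x : nat -> field_sort R K) : (forall n, 0 < mu n) ->
  weighted_norm p mu x =
    ('N[counting]_p [EFin \o (fun n => modulus (x n) / mu n)%R])%E.
Proof.
move=> mu0; apply: eq_Lnorm => n /=.
by rewrite inver gt_eqF.
Qed.

Lemma finite_support_lspace (R : realType) K (p : \bar R) d
    (x : nat -> field_sort R K) : (1 <= p)%E -> (0 < d)%N ->
  (forall n, (d <= n)%N -> x n = 0) -> lspace p x.
Proof.
move=> p1 d0 x0; have dR : 0 < d%:R :> R by rewrite ltr0n.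
have G0 : 0 < (d%:R : R) `^ fine p^-1 by rewrite powR_gt0.
(* Any bound on the finitely many entries will do; the 1 makes it positive. *)
pose B := \sum_(n < d) modulus (x n) + 1.
have B0 : 0 < B by rewrite ltr_wpDl// sumr_ge0// => i _; exact: modulus_ge0.
pose T := B * (2 * d%:R `^ fine p^-1).
have T0 : 0 < T by rewrite !mulr_gt0.
apply: (@le_lt_trans _ _ T%:E); last exact: ltry.
apply: (lnorm_le_of_head_tail p1 T0 d0 (a := fun n => modulus (x n))).
- by move=> k; exact: modulus_ge0.
- move=> n nd; rewrite mulfK ?gt_eqF ?mulr_gt0// /B (bigD1 (Ordinal nd))//=.
  rewrite -addrA lerDl addr_ge0// sumr_ge0// => i _; exact: modulus_ge0.
- move=> m; rewrite big_nat_cond big1 ?divr_ge0 ?(ltW T0)// => n /andP[/andP[dn _] _].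
  by rewrite x0// modulus0.
Qed.

Section GridSequence.
Variables (R : realType) (K : base_field) (M d : nat) (h : R).
Implicit Type f : {ffun 'I_d -> grid_index K M}.

Definition grid_seq f (n : nat) : field_sort R K :=
  if insub n is Some i then grid_point h (f i) else 0.

Lemma grid_seq_ord f (i : 'I_d) : grid_seq f i = grid_point h (f i).
Proof. by rewrite /grid_seq valK. Qed.

Lemma grid_seq_ge f n : (d <= n)%N -> grid_seq f n = 0.
Proof. by move=> dn; rewrite /grid_seq insubN// -leqNgt. Qed.

End GridSequence.

Section EllipsoidCovering.
Variables (R : realType) (K : base_field) (p q : \bar R) (mu : nat -> R).
Variables (eps : R) (d : nat).
Hypotheses (p1 : (1 <= p)%E) (q1 : (1 <= q)%E) (mu0 : forall n, 0 < mu n).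
Hypotheses (eps0 : 0 < eps) (d0 : (0 < d)%N).

Let dP : R := d%:R `^ fine p^-1.
Let dQ : R := d%:R `^ fine q^-1.
Let h : R := eps / (4 * dQ).

Let dR : 0 < d%:R :> R. Proof. by rewrite ltr0n. Qed.
Let dP0 : 0 < dP. Proof. by rewrite powR_gt0. Qed.
Let dQ0 : 0 < dQ. Proof. by rewrite powR_gt0. Qed.
Let h0 : 0 < h. Proof. by rewrite divr_gt0// mulr_gt0. Qed.

Let grid_bound : exists M, forall n, (n < d)%N -> mu n <= M%:R * h.
Proof.
pose S := \sum_(n < d) mu n.
have Sh : 0 <= S / h.
  by rewrite divr_ge0 ?(ltW h0)// sumr_ge0// => i _; exact: ltW.
exists (Num.truncn (S / h)).+1 => n nd.
rewrite -ler_pdivrMr//; apply: (@le_trans _ _ (S / h)); last first.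
  by have /andP[_ /ltW] := truncn_itv Sh.
rewrite ler_pM2r ?invr_gt0// /S (bigD1 (Ordinal nd))//= lerDl sumr_ge0//.
by move=> i _; exact: ltW.
Qed.

(** The centres are the grid sequences in the weighted [l^1] ball that contains
the truncated ellipsoid.  The weight of coordinate [n] is the inverse of
[s n = mu n / d^(1/p)], so that the radius of that ball is [2 d]. *)
Lemma ellipsoid_covering_le :
  (forall m, \sum_(d <= n < m) mu n <= eps / 2) ->
  (covering_number (@lspace R K q) (@ldist R K q) eps (@ellipsoid R K p mu)
   <= (expR (2 * d%:R)
       * \prod_(n < d) (2 + 16 * (mu n / eps * (dQ / dP))) ^+ sigma K 1)%:E)%E.
Proof.
move=> tl; have [M hM] := grid_bound.
pose s n := mu n / dP.
have s0 n : 0 < s n by rewrite divr_gt0.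
pose a (i : 'I_d) (b : grid_index K M) := modulus (grid_point h b) / s i.
pose P := [pred f : {ffun 'I_d -> grid_index K M} | \sum_i a i (f i) <= 2 * d%:R].
apply: (@le_trans _ _ #|P|%:R%:E); last first.
  rewrite lee_fin (le_trans (chernoff_count _ _))// ler_pM2l ?expR_gt0//.
  apply: ler_prod => i _; rewrite sumr_ge0//=.
  have [b0 b00] := @grid_zero R K M h.
  have aE b : a i b = modulus (grid_point h b - grid_point h b0) / s i.
    by rewrite b00 subr0.
  under eq_bigr do rewrite aE.
  apply: le_trans (sum_exp_grid_le b0 h0 (s0 i)) _.
  have -> : s i / h = 4 * (mu i / eps * (dQ / dP)).
    by rewrite /s /h; field; rewrite !gt_eqF.
  by rewrite mulrA -natrM.
apply: (covering_number_le (g := @grid_seq R K M d h)).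
  by move=> f _; apply: (finite_support_lspace q1 d0) => n; exact: grid_seq_ge.
move=> x [_]; rewrite weighted_normE// => xE.
pose ax n := modulus (x n) / mu n.
have ax0 n : 0 <= ax n by rewrite divr_ge0 ?modulus_ge0// ltW.
have xmu n : modulus (x n) <= mu n.
  have := lnorm_coord_le n p1 ltr01 ax0 xE.
  by rewrite ler_pdivrMr// mul1r.
have /choice[f fP] (i : 'I_d) : exists b : grid_index K M,
    modulus (grid_point h b) <= modulus (x i) /\
    modulus (x i - grid_point h b) <= 2 * h.
  by apply: grid_round => //; rewrite (le_trans (xmu _))// hM.
exists (finfun f).
  rewrite inE; apply: (@le_trans _ _ (\sum_(i < d) ax i * dP)).
    apply: ler_sum => i _; rewrite ffunE /a /s /ax invf_div mulrA mulrAC.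
    by rewrite ler_pM2r// ler_pM2r ?invr_gt0// (fP i).1.
  rewrite -mulr_suml -ler_pdivlMr//.
  by have := lnorm_sum_le p1 ltr01 d0 ax0 xE; rewrite mulr1.
apply: (lnorm_le_of_head_tail q1 eps0 d0
  (a := fun n => modulus (x n - grid_seq h (finfun f) n))).
- by move=> k; exact: modulus_ge0.
- move=> n nd; have := grid_seq_ord h (finfun f) (Ordinal nd) => /= ->.
  rewrite ffunE (le_trans (fP (Ordinal nd)).2)// -/dQ.
  have -> : 2 * h = eps / (2 * dQ) by rewrite /h; field; rewrite gt_eqF.
  exact: lexx.
- move=> m; apply: le_trans (tl m); rewrite big_nat [leRHS]big_nat.
  by apply: ler_sum => n /andP[dn _]; rewrite grid_seq_ge// subr0.
Qed.

(** Grid points of the box of half-sides [mu n / (2 d^(1/p))] are counted from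
below; two of them that are close to the same centre are at [l^1] distance at
most [16 h d], which bounds the fibres by [chernoff_count] with [T = 16 d] and
unit scale [h]. *)
Lemma ellipsoid_covering_ge :
  ((\prod_(n < d) (mu n / eps * (dQ / dP)) ^+ sigma K 1
    / (expR (16 * d%:R) * \prod_(n < d) 6 ^+ sigma K 1))%:E
   <= covering_number (@lspace R K q) (@ldist R K q) eps (@ellipsoid R K p mu))%E.
Proof.
have [M hM] := grid_bound.
have /andP[dP1 _] := powR_inv_exponent_bounds p1 d0; rewrite -/dP in dP1.
pose Y n := mu n / (2 * dP).
have Y0 n : 0 <= Y n by rewrite divr_ge0 ?mulr_ge0 ?ltW.
pose box (i : 'I_d) := [pred b : grid_index K M | modulus (grid_point h b) <= Y i].
pose P := [pred f : {ffun 'I_d -> grid_index K M} | f \in family box].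
set m := (X in _ / X).
have m0 : 0 < m by rewrite mulr_gt0 ?expR_gt0// prodr_gt0// => i _; rewrite exprn_gt0.
apply: (@le_trans _ _ (#|P|%:R / m)%:E).
  rewrite lee_fin ler_pM2r ?invr_gt0//.
  rewrite (_ : #|P| = \prod_(i < d) #|box i|)%N; last first.
    have -> : #|P| = #|family box| by apply: eq_card => f; rewrite !inE.
    by rewrite card_family foldrE big_image.
  rewrite natr_prod; apply: ler_prod => i _.
  rewrite exprn_ge0 ?mulr_ge0 ?invr_ge0 ?(ltW (mu0 _)) ?(ltW eps0) ?(ltW dQ0) ?(ltW dP0)//=.
  have Yh : Y i <= M%:R * h.
    rewrite (le_trans _ (hM _ (ltn_ord i)))// ler_pdivrMr ?mulr_gt0//.
    by rewrite ler_peMr ?(ltW (mu0 _))//; lra.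
  have <- : Y i / (2 * h) = mu i / eps * (dQ / dP).
    by rewrite /Y /h; field; rewrite !gt_eqF.
  exact: card_grid_ge.
apply: (covering_number_ge _ (g := @grid_seq R K M d h)) => //.
  move=> f fP; split.
    by apply: (finite_support_lspace p1 d0) => n; exact: grid_seq_ge.
  rewrite weighted_normE//.
  apply: (lnorm_le_of_head_tail p1 ltr01 d0).
  - by move=> n; rewrite divr_ge0 ?modulus_ge0// ltW.
  - move=> n nd; have := grid_seq_ord h f (Ordinal nd) => /= ->.
    have := familyP fP (Ordinal nd); rewrite inE/= => /le_trans fY.
    by rewrite ler_pdivrMr// mulrC fY// /Y -/dP mulrA mulr1.
  - move=> k; rewrite big_nat_cond big1 ?divr_ge0// => n /andP[/andP[dn _] _].
    by rewrite grid_seq_ge// modulus0 mul0r.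
move=> y; set F := [pred f | _].
have [[f0 Ff0]|noF] := pselect (exists f, F f); last first.
  by rewrite eq_card0 ?(ltW m0)// => f; apply/negP => Ff; apply: noF; exists f.
have near f : F f -> \sum_(i < d) modulus (grid_point h (f i) - y i)
    <= 2 * eps * d%:R / dQ.
  case/andP => _ /asboolP fy.
  have := lnorm_sum_le q1 eps0 d0 _ fy => /(_ (fun=> modulus_ge0 _)).
  by under eq_bigr do rewrite grid_seq_ord.
pose a (i : 'I_d) (b : grid_index K M) :=
  modulus (grid_point h b - grid_point h (f0 i)) / h.
apply: (@le_trans _ _ #|[pred f : {ffun 'I_d -> grid_index K M} |
    \sum_i a i (f i) <= 16 * d%:R]|%:R).
  rewrite ler_nat; apply/fintype.subset_leq_card/fintype.subsetP => f.
  move=> Ff; rewrite inE -mulr_suml ler_pdivrMr//.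
  apply: (@le_trans _ _ (\sum_(i < d) (modulus (grid_point h (f i) - y i)
      + modulus (grid_point h (f0 i) - y i)))).
    apply: ler_sum => i _.
    rewrite -(modulusN (grid_point h (f0 i) - y i)).
    by apply: le_trans (modulusD _ _); rewrite opprB addrA subrK.
  rewrite big_split/= (le_trans (lerD (near _ Ff) (near _ Ff0)))//.
  have -> : 2 * eps * d%:R / dQ = 8 * d%:R * h by rewrite /h; field; rewrite gt_eqF.
  by rewrite -mulrDl -mulrDl -natrD.
apply: (le_trans (chernoff_count _ _)); rewrite /m ler_pM2l ?expR_gt0//.
apply: ler_prod => i _; rewrite sumr_ge0//=.
have := sum_exp_grid_le (f0 i) h0 h0; rewrite divff ?gt_eqF// mulr1.
by rewrite (_ : 2 + 4 = 6)// -natrD.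
Qed.

End EllipsoidCovering.

Lemma ln_prod (R : realType) (n : nat) (F : 'I_n -> R) :
  (forall i, 0 < F i) -> ln (\prod_i F i) = \sum_i ln (F i).
Proof.
move=> F0; suff [] : 0 < \prod_i F i /\ ln (\prod_i F i) = \sum_i ln (F i) by [].
apply: (big_ind2 (fun x y => 0 < x /\ ln x = y)).
- by split=> //; exact: ln1.
- move=> x y x' y' [x0 <-] [x'0 <-]; split; first by rewrite mulr_gt0.
  by rewrite lnM ?posrE.
- by move=> i _.
Qed.

Lemma ln_le_sub1 (R : realType) (x : R) : 0 < x -> ln x <= x - 1.
Proof.
by move=> x0; rewrite -{1}(subrK 1 x) addrC; apply: le_ln1Dx; lra.
Qed.

(** The hypotheses on [S] express the geometric decay of the semi-axes: seen from
the last index [d.-1], both the reciprocals of the earlier axes and the later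
axes are summable, with sums comparable to one term. *)
Lemma entropy_bounds (R : realType) (K : base_field) (p q : \bar R)
    (mu : nat -> R) (eps S : R) (d : nat) :
  (1 <= p)%E -> (1 <= q)%E -> (forall n, 0 < mu n) -> 0 < eps -> (0 < d)%N ->
  1 <= S -> \sum_(n < d) mu d.-1 / mu n <= S ->
  (forall m, \sum_(d <= n < m) mu n <= S * mu d.-1) ->
  2 * S * mu d.-1 <= eps ->
  exists2 H, metric_entropy (@lspace R K q) (@ldist R K q) eps
               (@ellipsoid R K p mu) = H%:E &
    (sigma K 1)%:R * (\sum_(n < d) ln (mu n / eps)
       + d%:R * ((fine q^-1 - fine p^-1) * ln d%:R - 21)) <= H * ln 2 /\
    H * ln 2 <= (sigma K 1)%:R * (\sum_(n < d) ln (mu n / mu d.-1)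
       + d%:R * ((fine q^-1 - fine p^-1) * ln d%:R + 17 + 2 * S)).
Proof.
move=> p1 q1 mu0 eps0 d0 S1 sumS tailS epsS.
have dR : 0 < d%:R :> R by rewrite ltr0n.
have d1 : 1 <= d%:R :> R by rewrite ler1n.
pose dP : R := d%:R `^ fine p^-1; pose dQ : R := d%:R `^ fine q^-1.
have dP0 : 0 < dP by rewrite powR_gt0.
have dQ0 : 0 < dQ by rewrite powR_gt0.
have /andP[dQ1 _] := powR_inv_exponent_bounds q1 d0.
have /andP[_ dPd] := powR_inv_exponent_bounds p1 d0.
rewrite -/dQ in dQ1; rewrite -/dP in dPd.
pose g := dQ / dP; have g0 : 0 < g by rewrite divr_gt0.
have lng : ln g = (fine q^-1 - fine p^-1) * ln d%:R.
  by rewrite ln_div ?posrE// !ln_powR mulrBl.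
have s1 : 1 <= (sigma K 1)%:R :> R by case: K; rewrite ler1n.
have tl m : \sum_(d <= n < m) mu n <= eps / 2.
  by rewrite (le_trans (tailS m))//; lra.
have up := ellipsoid_covering_le K p1 q1 mu0 eps0 d0 tl.
have lo := ellipsoid_covering_ge K p1 q1 mu0 eps0 d0.
rewrite -/dP -/dQ -/g in up lo.
have me0 n : 0 < mu n / eps by rewrite divr_gt0.
have meg0 n : 0 < mu n / eps * g by rewrite mulr_gt0.
have lnX (x : R) : 0 < x -> ln (x ^+ sigma K 1) = (sigma K 1)%:R * ln x.
  by move=> x0; rewrite lnXn// mulr_natl.
have pg0 : 0 < \prod_(n < d) (mu n / eps * g) ^+ sigma K 1.
  by apply: prodr_gt0 => i _; rewrite exprn_gt0.
have p60 : 0 < \prod_(n < d) 6 ^+ sigma K 1 :> R.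
  by apply: prodr_gt0 => i _; rewrite exprn_gt0.
have e60 : 0 < expR (16 * d%:R) * \prod_(n < d) 6 ^+ sigma K 1 :> R.
  by rewrite mulr_gt0 ?expR_gt0.
have [H HE /andP[Hlo Hup]] := metric_entropy_between (divr_gt0 pg0 e60) lo up.
exists H => //; split.
  apply: le_trans Hlo.
  rewrite ln_div ?posrE// lnM ?posrE ?expR_gt0// expRK.
  rewrite !ln_prod//; try by move=> i; rewrite exprn_gt0.
  under [in leRHS]eq_bigr do rewrite lnX// lnM ?posrE//.
  rewrite -mulr_sumr big_split/= !sumr_const card_ord lnX//.
  rewrite lng -[(_ * ln 6) *+ d]mulr_natl -[(_ * ln d%:R) *+ d]mulr_natl.
  set X := \sum_(i < d) _.
  have l6 : ln 6 <= 5 :> R by rewrite (le_trans (ln_le_sub1 _))//; lra.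
  set Z := _ * ln d%:R; set s := (sigma K 1)%:R in s1 *.
  suff : 16 * d%:R + d%:R * (s * ln 6) <= s * (d%:R * 21) by lra.
  have : 16 * d%:R <= s * (d%:R * 16) by rewrite mulrCA mulrC ler_pM2l// ler_peMl.
  have : d%:R * (s * ln 6) <= d%:R * (s * 5).
    by rewrite ler_pM2l// ler_pM2l//; lra.
  lra.
apply: le_trans Hup _.
have f0 n : 0 < 2 + 16 * (mu n / eps * g) by rewrite ltr_wpDr// mulr_ge0// ltW.
rewrite lnM ?posrE ?expR_gt0//; last by apply: prodr_gt0 => i _; rewrite exprn_gt0.
rewrite expRK ln_prod; last by move=> i; rewrite exprn_gt0.
under eq_bigr do rewrite lnX//.
rewrite -mulr_sumr.
have mS : mu d.-1 <= eps.
  rewrite (le_trans _ epsS)// ler_peMl ?(ltW (mu0 _))//; lra.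
(* With w = mu n / mu d.-1, the argument is at most w g (16 + 2 / (w g)), and
   ln x <= x - 1 bounds the logarithm of the last factor, using 1 / g <= d. *)
have lnle n : ln (2 + 16 * (mu n / eps * g)) <=
    ln (mu n / mu d.-1) + ln g + 15 + 2 * (d%:R * (mu d.-1 / mu n)).
  pose w := mu n / mu d.-1; have w0 : 0 < w by rewrite divr_gt0.
  have wg0 : 0 < w * g by rewrite mulr_gt0.
  have y0 : 0 < 16 + 2 / (w * g) by rewrite ltr_wpDr// divr_ge0// ltW.
  apply: (@le_trans _ _ (ln (w * g * (16 + 2 / (w * g))))).
    have -> : w * g * (16 + 2 / (w * g)) = 2 + 16 * (w * g).
      by field; rewrite !gt_eqF.
    have f1 : 0 < 2 + 16 * (w * g) by rewrite ltr_wpDr// mulr_ge0// ltW.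
    rewrite ler_ln ?posrE ?f0 ?f1// lerD2l ler_wpM2l// ler_wpM2r ?(ltW g0)//.
    by rewrite /w ler_wpM2l ?(ltW (mu0 _))// lef_pV2 ?posrE.
  rewrite lnM ?posrE// lnM ?posrE//.
  suff : 2 / (w * g) <= 2 * (d%:R * (mu d.-1 / mu n)).
    by have := ln_le_sub1 y0; rewrite -/w; lra.
  have -> : 2 / (w * g) = 2 * (dP / dQ * (mu d.-1 / mu n)).
    by rewrite /w /g; field; rewrite !gt_eqF.
  have ww0 : 0 < mu d.-1 / mu n by rewrite divr_gt0.
  by rewrite ler_pM2l// ler_pM2r// ler_pdivrMr// (le_trans dPd)// ler_peMr.
have sumle : \sum_(n < d) ln (2 + 16 * (mu n / eps * g)) <=
    \sum_(n < d) ln (mu n / mu d.-1) + d%:R * (ln g + 15) + 2 * (d%:R * S).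
  apply: (@le_trans _ _ (\sum_(n < d) (ln (mu n / mu d.-1) + (ln g + 15)
      + 2 * (d%:R * (mu d.-1 / mu n))))).
    by apply: ler_sum => n _; rewrite addrA lnle.
  rewrite 2!big_split/= sumr_const card_ord -2!mulr_sumr.
  rewrite -[(ln g + 15) *+ d]mulr_natl lerD2l.
  by rewrite ler_pM2l// ler_pM2l.
set s := (sigma K 1)%:R in s1 *.
have := ler_wpM2l (le_trans ler01 s1) sumle.
have : 2 * d%:R <= s * (2 * d%:R) by rewrite ler_peMl// mulr_ge0.
rewrite -lng; lra.
Qed.

(** * Growth of a decay rate function *)

Section Decay.
Variables (R : realType) (tstar : R) (psi : R -> R).
Hypothesis decay : decay_rate_function tstar psi.

Lemma decay_rate_gt0 t : tstar < t -> 0 < psi t.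
Proof.
case: decay => _ _ img _ tt; have : (psi @` `]tstar, +oo[%classic) (psi t).
  by exists t => //; rewrite /= in_itv/= tt.
by rewrite img/= in_itv/= andbT.
Qed.

(** The graph of [psi] lies above the line through the origin and [(t, psi t)]
to the right of [t]. *)
Lemma decay_rate_slope t s : tstar < t -> t <= s ->
  psi t / t * (s - t) <= psi s - psi t.
Proof.
case: decay => t0 _ _ mon tt ts; have ss : tstar < s by exact: lt_le_trans ts.
have tp : 0 < t by exact: le_lt_trans tt.
have sp : 0 < s by exact: le_lt_trans ss.
have : psi t / t <= psi s / s by apply: mon; rewrite ?in_itv/= ?tt ?ss.
rewrite ler_pdivlMr// mulrBr divfK ?gt_eqF//; lra.
Qed.

Lemma decay_rate_homo t s : tstar < t -> t <= s -> psi t <= psi s.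
Proof.
move=> tt ts; have := decay_rate_slope tt ts.
have tp : 0 < t by case: decay => t0 _ _ _; exact: le_lt_trans tt.
have : 0 <= psi t / t * (s - t).
  by rewrite mulr_ge0 ?subr_ge0// divr_ge0 ?ltW// decay_rate_gt0.
lra.
Qed.

Lemma psi_invP L : 0 < L ->
  tstar < psi_inv tstar psi L /\ psi (psi_inv tstar psi L) = L.
Proof.
move=> L0; have [_ _ img _] := decay.
have LI : (psi @` `]tstar, +oo[%classic) L by rewrite img/= in_itv/= L0.
split; last by apply: pinvK; rewrite inE.
have : (`]tstar, +oo[%classic : set R) (psi_inv tstar psi L).
  apply: (@surjpinv_image_sub _ _ (fun=> 0) _ (psi @` `]tstar, +oo[%classic) psi).
    by move=> y.
  by exists L.
by rewrite /= in_itv/= andbT.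
Qed.

Lemma decay_rate_linear_growth : exists (c : R) (n0 : nat),
  [/\ 0 < c, tstar < n0%:R &
    forall t s, n0%:R <= t -> t <= s -> c * (s - t) <= psi s - psi t].
Proof.
have [t0 _ _ mon] := decay.
pose n0 := (Num.truncn tstar).+1.
have n0t : tstar < n0%:R by have /andP[_ ->] := truncn_itv t0.
exists (psi n0%:R / n0%:R), n0; split => //.
  by rewrite divr_gt0 ?ltr0n// decay_rate_gt0.
move=> t s nt ts; have tt : tstar < t by exact: lt_le_trans nt.
apply: le_trans (decay_rate_slope tt ts); rewrite ler_wpM2r ?subr_ge0//.
by apply: mon; rewrite ?in_itv/= ?tt ?n0t.
Qed.

End Decay.

Section SemiAxes.
Variables (R : realType) (tstar c0 : R) (psi : R -> R).
Hypotheses (decay : decay_rate_function tstar psi) (c00 : 0 < c0).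
Let mu := semi_axes c0 psi.

Lemma semi_axes_gt0 n : 0 < mu n.
Proof. by rewrite mulr_gt0 ?expR_gt0. Qed.

Lemma ln_semi_axes_div m n : ln (mu m / mu n) = ln 2 * (psi n.+1%:R - psi m.+1%:R).
Proof.
rewrite ln_div ?posrE ?semi_axes_gt0// /mu /semi_axes !lnM ?posrE ?expR_gt0//.
by rewrite !expRK; ring.
Qed.

(** Linear growth gives the decay from index [n0] on; for smaller indices
monotonicity is enough, at the price of the factor [B = rho ^- n0]. *)
Lemma semi_axes_geometric : nonincreasing_seq mu ->
  exists (B rho : R), [/\ 1 <= B, 0 < rho, rho < 1 &
    forall n m, (n <= m)%N -> mu m <= B * rho ^+ (m - n) * mu n].
Proof.
move=> mono; have [c [n0 [cpos n0t lin]]] := decay_rate_linear_growth decay.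
have l2 : 0 < ln 2 :> R by rewrite ln_gt0 ?ltr1n.
pose rho := expR (- (ln 2 * c)).
have r0 : 0 < rho by exact: expR_gt0.
have r1 : rho < 1 by rewrite -expR0 ltr_expR oppr_lt0 mulr_gt0.
have far n m : (n0 <= n)%N -> (n <= m)%N -> mu m <= rho ^+ (m - n) * mu n.
  move=> nn nm; rewrite -ler_pdivrMr ?semi_axes_gt0//.
  have mn0 : 0 < mu m / mu n by rewrite divr_gt0 ?semi_axes_gt0.
  rewrite -(lnK mn0) ln_semi_axes_div -expRM_natl ler_expR mulrN mulrCA.
  rewrite -mulrN ler_pM2l// -opprB lerN2.
  have := lin n.+1%:R m.+1%:R; rewrite !ler_nat => /(_ (leqW nn) nm).
  rewrite -[m.+1%:R]natr1 -[n.+1%:R]natr1 natrB//; lra.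
exists (rho ^- n0), rho; split=> //.
  by rewrite -exprVn exprn_ege1// invf_ge1// ltW.
move=> n m nm; rewrite -exprVn.
have rle k l : (k <= l)%N -> rho ^+ l <= rho ^+ k.
  by move=> kl; rewrite ler_wiXn2l// ltW.
have rn0 : 0 < rho ^+ n0 by rewrite exprn_gt0.
rewrite exprVn -mulrA mulrC -ler_pdivrMr ?invr_gt0// invrK.
have [n0n|nn0] := leqP n0 n.
  apply: le_trans (far _ _ n0n nm).
  by rewrite ler_piMr ?(ltW (semi_axes_gt0 _))// exprn_ile1// ltW.
have [n0m|mn0] := leqP n0 m.
  apply: (@le_trans _ _ (rho ^+ (m - n0) * mu n0 * rho ^+ n0)).
    by rewrite ler_pM2r// far.
  rewrite mulrAC -exprD subnK//; apply: ler_pM; rewrite ?exprn_ge0 ?(ltW r0) ?(ltW (semi_axes_gt0 _))//.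
    by rewrite rle// leq_subr.
  by apply: mono; exact: ltnW.
rewrite mulrC; apply: ler_pM; rewrite ?exprn_ge0 ?(ltW r0) ?(ltW (semi_axes_gt0 _))//.
  by rewrite rle// (leq_trans (leq_subr _ _))// ltnW.
exact: mono.
Qed.

Lemma psi_averageE d : (0 < d)%N ->
  ln 2 * (d%:R * psi_average psi d) = \sum_(n < d) ln (mu n / mu d.-1).
Proof.
move=> d0; rewrite /psi_average [d%:R * _]mulrA divff ?pnatr_eq0 -?lt0n// mul1r.
rewrite big_add1/= big_mkord mulr_sumr; apply: eq_bigr => n _.
by rewrite ln_semi_axes_div prednK.
Qed.

End SemiAxes.

(** * Choice of the dimension *)

Section GeometricSums.
Variables (R : realType) (mu : nat -> R) (B rho : R) (d : nat).
Hypotheses (mu0 : forall n, 0 < mu n) (B1 : 1 <= B).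
Hypotheses (rho0 : 0 < rho) (rho1 : rho < 1) (d0 : (0 < d)%N).
Hypothesis geo : forall n m, (n <= m)%N -> mu m <= B * rho ^+ (m - n) * mu n.

Lemma geometric_head_sum : \sum_(n < d) mu d.-1 / mu n <= B / (1 - rho).
Proof.
apply: (@le_trans _ _ (\sum_(n < d) B * rho ^+ (d.-1 - n))).
  apply: ler_sum => n _; rewrite ler_pdivrMr// geo//.
  by rewrite -ltnS prednK.
rewrite -mulr_sumr ler_pM2l; last exact: lt_le_trans B1.
rewrite -(big_mkord xpredT (fun n => rho ^+ (d.-1 - n))) big_nat_rev/=.
rewrite (le_trans _ (sum_geometric_le d (ltW rho0) rho1))//.
rewrite big_nat [leRHS]big_nat; apply: ler_sum => i /andP[_ id].
have -> // : (d.-1 - (0 + d - i.+1) = i)%N.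
by move: id; case: (d) d0 => //= k _ ik; rewrite subSS subKn.
Qed.

Lemma geometric_tail_sum m :
  \sum_(d <= n < m) mu n <= B / (1 - rho) * mu d.-1.
Proof.
apply: (@le_trans _ _ (\sum_(d <= n < m) B * rho ^+ (n - d) * mu d.-1)).
  rewrite big_nat [leRHS]big_nat; apply: ler_sum => n /andP[dn _].
  have dn' : (d.-1 <= n)%N by rewrite (leq_trans (leq_pred _)).
  rewrite (le_trans (geo dn'))// ler_pM2r// ler_pM2l ?(lt_le_trans ltr01)//.
  by rewrite ler_wiXn2l ?(ltW rho0) ?(ltW rho1)// leq_sub2l// leq_pred.
rewrite -mulr_suml -mulr_sumr ler_pM2r// ler_pM2l ?(lt_le_trans ltr01)//.
rewrite -{1}[d]add0n big_addn.
rewrite (eq_bigr (fun i => rho ^+ i)) => [|i _]; last by rewrite addnK.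
exact: sum_geometric_le (ltW rho0) rho1.
Qed.

End GeometricSums.

Lemma sigmaE (R : realType) K d : (sigma K d)%:R = (sigma K 1)%:R * d%:R :> R.
Proof. by case: K; rewrite /sigma -natrM ?mul1n ?muln1. Qed.

Section Asymptotics.
Variables (R : realType) (K : base_field) (p q : \bar R).
Variables (tstar c0 : R) (psi : R -> R).
Hypotheses (p1 : (1 <= p)%E) (q1 : (1 <= q)%E).
Hypotheses (decay : decay_rate_function tstar psi) (c00 : 0 < c0).
Local Notation mu := (semi_axes c0 psi).
Local Notation L0 eps := (log2 eps^-1 + log2 c0).

Variables (c S : R) (n0 : nat).
Hypotheses (cpos : 0 < c) (n0t : tstar < n0%:R).
Hypothesis lin : forall t s, n0%:R <= t -> t <= s -> c * (s - t) <= psi s - psi t.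
Hypothesis S1 : 1 <= S.
Hypothesis head_sum : forall d, (0 < d)%N -> \sum_(n < d) mu d.-1 / mu n <= S.
Hypothesis tail_sum : forall d m, (0 < d)%N ->
  \sum_(d <= n < m) mu n <= S * mu d.-1.

(** For small [eps] this is the least index at which [psi] exceeds
[log2 (2 S c0 / eps)]: the last semi-axis kept is at most [eps / (2 S)], and the
one before is at least that. *)
Definition dimension_at (eps : R) : nat :=
  (Num.truncn (psi_inv tstar psi (L0 eps + log2 (2 * S)))).+1.
Local Notation d := dimension_at.

Let l2 : 0 < ln 2 :> R. Proof. by rewrite ln_gt0 ?ltr1n. Qed.

Let lA0 : 0 <= log2 (2 * S).
Proof.
have S_ge1 : 1 <= S := S1.
by rewrite divr_ge0 ?(ltW l2)// ln_ge0//; lra.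
Qed.

Let psi_inv_ge L : psi n0.+2%:R < L ->
  [/\ n0.+2%:R <= psi_inv tstar psi L & psi (psi_inv tstar psi L) = L].
Proof.
move=> XL; have n2t : tstar < n0.+2%:R.
  by rewrite (lt_le_trans n0t)// ler_nat leqW.
have L_gt0 : 0 < L by rewrite (lt_trans _ XL)// (decay_rate_gt0 decay).
have [tt tL] := psi_invP decay L_gt0; split=> //.
rewrite leNgt; apply/negP => /ltW/(decay_rate_homo decay tt).
by rewrite tL leNgt XL.
Qed.

(** The shift by [log2 (2 S)] of the argument of [psi_inv] is harmless by linear
growth; the remaining [1] is the rounding. *)
Lemma dimension_at_bound eps : psi n0.+2%:R < L0 eps ->
  `|(d eps)%:R - psi_inv tstar psi (L0 eps)| <= 1 + log2 (2 * S) / c.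
Proof.
move=> XL; have lA_ge0 : 0 <= log2 (2 * S) := lA0.
have [t'n t'L] := psi_inv_ge XL.
have XL' : psi n0.+2%:R < L0 eps + log2 (2 * S) by rewrite ltr_wpDr.
have [tn tL] := psi_inv_ge XL'; rewrite /dimension_at.
set t := psi_inv tstar psi (_ + _) in tn tL *.
set t' := psi_inv tstar psi _ in t'n t'L *.
have /andP[d1 d2] : (Num.truncn t)%:R <= t < (Num.truncn t).+1%:R.
  by apply: truncn_itv; rewrite (le_trans _ tn).
have n02 : n0%:R <= n0.+2%:R :> R by rewrite ler_nat leqW.
have tt' : t' <= t.
  rewrite leNgt; apply/negP => tt'.
  have := lin (le_trans n02 tn) (ltW tt'); rewrite tL t'L => H.
  have : 0 < c * (t' - t) by rewrite mulr_gt0 ?subr_gt0.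
  lra.
have : t - t' <= log2 (2 * S) / c.
  rewrite ler_pdivlMr// mulrC.
  by have := lin (le_trans n02 t'n) tt'; rewrite tL t'L; lra.
rewrite -natr1 in d2 *; rewrite ger0_norm; lra.
Qed.

(** The condition on [eps] puts all indices from [(d eps).-1] on in the range of
linear growth.  With [D] real dimensions, [22 + 2 S] collects what
[entropy_bounds] leaves per dimension, the logarithm of [2 S], and the passage
from [ln d] to [ln D]. *)
Lemma metric_entropy_estimate eps : 0 < eps -> psi n0.+2%:R < L0 eps ->
  exists r : R,
    metric_entropy (@lspace R K q) (@ldist R K q) eps (@ellipsoid R K p mu)
    = ((sigma K (d eps))%:R * (psi_average psi (d eps)
        + (fine q^-1 - fine p^-1) * log2 (sigma K (d eps))%:R + r))%:E /\
    `|r| <= (1 + (22 + 2 * S) / (c * ln 2)) * `|psi_difference psi (d eps)|.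
Proof.
move=> eps0 XL; have S_ge1 : 1 <= S := S1.
have XL' : psi n0.+2%:R < L0 eps + log2 (2 * S) by rewrite ltr_wpDr.
have [tn tL] := psi_inv_ge XL'; rewrite /dimension_at.
set t := psi_inv tstar psi _ in tn tL *.
have /andP[] : (Num.truncn t)%:R <= t < (Num.truncn t).+1%:R.
  by apply: truncn_itv; rewrite (le_trans _ tn).
have : (n0.+2 <= Num.truncn t)%N by rewrite truncn_ge_nat// (le_trans _ tn).
set e := Num.truncn t => en et te.
have en0 : n0%:R <= e%:R :> R by rewrite ler_nat (leq_trans _ en)// leqW.
have etst : tstar < e%:R by exact: lt_le_trans en0.
have A0 : 0 < 2 * S by lra.
have ln2L : ln 2 * (L0 eps + log2 (2 * S)) = ln c0 + ln (2 * S) - ln eps.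
  by rewrite /log2 lnV ?posrE//; field; rewrite gt_eqF.
(* Here d = e + 1: psi e <= log2 (2 S c0 / eps) <= psi (e + 1). *)
have psie : psi e%:R <= L0 eps + log2 (2 * S).
  by rewrite -tL; exact: (decay_rate_homo decay etst et).
have psie1 : L0 eps + log2 (2 * S) <= psi e.+1%:R.
  rewrite -tL; apply: (decay_rate_homo decay _ (ltW te)).
  exact: lt_le_trans et.
have mu0 n : 0 < mu n by exact: semi_axes_gt0.
have lnmu n : ln (mu n) = ln c0 - ln 2 * psi n.+1%:R.
  by rewrite /semi_axes lnM ?posrE ?expR_gt0// expRK.
have epsS : 2 * S * mu e <= eps.
  have A1 : 0 < 2 * S * mu e by exact: mulr_gt0.
  rewrite -ler_ln ?posrE// lnM ?posrE// lnmu.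
  have : ln 2 * (L0 eps + log2 (2 * S)) <= ln 2 * psi e.+1%:R by rewrite ler_pM2l.
  by rewrite ln2L; lra.
have epsl : ln eps <= ln c0 + ln (2 * S) - ln 2 * psi e%:R.
  have : ln 2 * psi e%:R <= ln 2 * (L0 eps + log2 (2 * S)) by rewrite ler_pM2l.
  by rewrite ln2L; lra.
have [H HE [Hlo Hup]] := entropy_bounds K p1 q1 mu0 eps0 (ltn0Sn e) S1
  (head_sum (ltn0Sn e)) (fun m => tail_sum m (ltn0Sn e)) epsS.
rewrite HE -/e.
set z := psi_difference psi e.+1.
(* The difference function is bounded below, so that constants are O(zeta). *)
have zc : c <= z.
  have ee : e%:R <= e.+1%:R :> R by rewrite ler_nat.
  have dist1 : e.+1%:R - e%:R = 1 :> R by rewrite -natr1 addrAC subrr add0r.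
  by have := lin en0 ee; rewrite dist1 mulr1.
have avg := psi_averageE psi c00 (ltn0Sn e).
set beta := fine q^-1 - fine p^-1 in Hlo Hup *.
have beta1 : - 1 <= beta <= 1.
  have /andP[? ?] := fine_inv_bounds p1; have /andP[? ?] := fine_inv_bounds q1.
  by rewrite /beta; apply/andP; split; lra.
set s := (sigma K 1)%:R in Hlo Hup.
have s1 : 1 <= s by rewrite /s; case: (K); rewrite ler1n.
have s2 : s <= 2 by rewrite /s; case: (K); rewrite ler_nat.
have e1 : 0 < e.+1%:R :> R by rewrite ltr0n.
pose D : R := s * e.+1%:R.
have D0 : 0 < D by rewrite mulr_gt0//; lra.
have DE : (sigma K e.+1)%:R = D by exact: sigmaE.
rewrite DE.
set delta := psi_average psi e.+1 in avg *.
pose r := H / D - delta - beta * log2 D.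
exists r; split.
  by congr EFin; rewrite /r; field; rewrite gt_eqF.
have lnD : ln D = ln s + ln e.+1%:R by rewrite lnM ?posrE//; lra.
have ls : 0 <= ln s <= 1.
  by rewrite ln_ge0//= (le_trans (ln_le_sub1 _)); lra.
have rE : ln 2 * r * D = H * ln 2 - D * (ln 2 * delta + beta * ln D).
  by rewrite /r /log2; field; rewrite !gt_eqF.
have bls : `|beta * ln s| <= 1.
  rewrite normrM -[leRHS]mulr1; apply: ler_pM => //.
    by rewrite ler_norml.
  by rewrite ger0_norm; case/andP: ls.
have lnA : ln (2 * S) <= 2 * S by rewrite (le_trans (ln_le_sub1 _))//; lra.
have sumw : \sum_(n < e.+1) ln (mu n / mu e) = ln 2 * (e.+1%:R * delta).
  by rewrite avg.
(* Replacing eps by mu e costs ln (eps / mu e) <= ln (2 S) + ln 2 * zeta, as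
   eps is at most 2 S times the previous semi-axis. *)
have sumlo : \sum_(n < e.+1) ln (mu n / mu e) - e.+1%:R * (ln (2 * S) + ln 2 * z)
    <= \sum_(n < e.+1) ln (mu n / eps).
  rewrite mulr_natl -[X in _ *+ X]card_ord -sumr_const -sumrB.
  apply: ler_sum => n _; rewrite !ln_div ?posrE// [ln (mu e)]lnmu /z.
  by rewrite /psi_difference/=; lra.
have rup : ln 2 * r <= 18 + 2 * S.
  rewrite -(ler_pM2r D0) rE.
  have -> : (18 + 2 * S) * D = s * (e.+1%:R * (18 + 2 * S)) by rewrite /D; ring.
  move: Hup; rewrite sumw => Hup.
  rewrite lerBlDr (le_trans Hup)// lnD /D -!mulrA -mulrDr ler_pM2l; last lra.
  rewrite mulrCA -!mulrDr ler_pM2l//.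
  move: bls; rewrite ler_norml => /andP[? ?].
  lra.
have rlo : - (ln 2 * z + 22 + 2 * S) <= ln 2 * r.
  rewrite -(ler_pM2r D0) rE.
  have -> : - (ln 2 * z + 22 + 2 * S) * D = s * (e.+1%:R * - (ln 2 * z + 22 + 2 * S)).
    by rewrite /D; ring.
  rewrite lerBrDr (le_trans _ Hlo)//.
  rewrite lnD /D -!mulrA -mulrDr ler_pM2l; last lra.
  rewrite (le_trans _ (lerD sumlo (lexx _)))// sumw.
  rewrite [ln 2 * (e.+1%:R * delta)]mulrCA -mulrBr -!mulrDr ler_pM2l//.
  move: bls; rewrite ler_norml => /andP[? ?].
  lra.
have z0 : 0 < z by exact: lt_le_trans zc.
rewrite (gtr0_norm z0) -(ler_pM2l l2) -{1}(gtr0_norm l2) -normrM.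
have -> : ln 2 * ((1 + (22 + 2 * S) / (c * ln 2)) * z)
    = ln 2 * z + (22 + 2 * S) * (z / c).
  by field; rewrite !gt_eqF.
have : 22 + 2 * S <= (22 + 2 * S) * (z / c).
  by rewrite ler_peMr ?ler_pdivlMr ?mul1r//; lra.
have : 0 < ln 2 * z by rewrite mulr_gt0.
by rewrite ler_norml => ? ?; apply/andP; split; lra.
Qed.

End Asymptotics.

Theorem theorem5 (R : realType) (K : base_field) (p q : \bar R)
    (tstar c0 : R) (psi : R -> R) :
  (1 <= p)%E -> (1 <= q)%E ->
  decay_rate_function tstar psi ->
  0 < c0 ->
  nonincreasing_seq (semi_axes c0 psi) ->
  exists (d : R -> nat) (r : R -> R),
    [/\ (fun eps : R =>
           (d eps)%:R - psi_inv tstar psi (log2 eps^-1 + log2 c0))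
          =O_ (0^'+) (fun=> 1 : R),
        r =O_ (0^'+) (fun eps : R => psi_difference psi (d eps))
      & \forall eps \near 0^'+,
          metric_entropy (@lspace R K q) (@ldist R K q) eps
            (@ellipsoid R K p (semi_axes c0 psi))
          = ((sigma K (d eps))%:R *
             (psi_average psi (d eps)
              + (fine q^-1 - fine p^-1) * log2 (sigma K (d eps))%:R
              + r eps))%:E ].
Proof.
move=> p1 q1 decay c00 mono.
have [c [n0 [cpos n0t lin]]] := decay_rate_linear_growth decay.
have [B [rho [B1 rho0 rho1 geo]]] := semi_axes_geometric decay c00 mono.
pose mu := semi_axes c0 psi.
have [S [S1 hd tl]] : exists S, [/\ 1 <= S,
    forall d, (0 < d)%N -> \sum_(n < d) mu d.-1 / mu n <= S &
    forall d m, (0 < d)%N -> \sum_(d <= n < m) mu n <= S * mu d.-1].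
  have mu0 n : 0 < mu n by exact: semi_axes_gt0.
  exists (B / (1 - rho)); split.
  - by rewrite ler_pdivlMr ?subr_gt0//; lra.
  - by move=> d d0; exact: geometric_head_sum.
  - by move=> d m d0; exact: geometric_tail_sum.
pose d := dimension_at tstar c0 psi S.
have l2 : 0 < ln 2 :> R by rewrite ln_gt0 ?ltr1n.
have small : \forall eps \near 0^'+,
    0 < eps /\ psi n0.+2%:R < log2 eps^-1 + log2 c0.
  near=> eps; have eps0 : 0 < eps by [].
  split=> //; rewrite -ltrBlDr /log2 lnV ?posrE// ltr_pdivlMr// ltrNr.
  rewrite -ltr_expR lnK ?posrE//.
  near: eps; apply: nbhs_right_lt; exact: expR_gt0.
pose good eps r :=
  metric_entropy (@lspace R K q) (@ldist R K q) eps
    (@ellipsoid R K p (semi_axes c0 psi))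
  = ((sigma K (d eps))%:R * (psi_average psi (d eps)
      + (fine q^-1 - fine p^-1) * log2 (sigma K (d eps))%:R + r))%:E /\
  `|r| <= (1 + (22 + 2 * S) / (c * ln 2)) * `|psi_difference psi (d eps)|.
have /choice[r rP] eps : exists r,
    0 < eps /\ psi n0.+2%:R < log2 eps^-1 + log2 c0 -> good eps r.
  have [[eps0 XL]|no] := pselect (0 < eps /\ psi n0.+2%:R < log2 eps^-1 + log2 c0).
    have [r rP] := metric_entropy_estimate K p1 q1 decay c00 cpos n0t lin
      S1 hd tl eps0 XL.
    by exists r.
  by exists 0.
exists d, r; split.
- apply/eqO_exP; exists (1 + `|log2 (2 * S) / c|); first by rewrite ltr_wpDr.
  near=> eps; have [eps0 XL] : 0 < eps /\ psi n0.+2%:R < log2 eps^-1 + log2 c0.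
    by near: eps.
  rewrite normr1 mulr1.
  apply: le_trans (dimension_at_bound decay cpos n0t lin S1 XL) _.
  by rewrite lerD2l ler_norm.
- apply/eqO_exP; exists (1 + (22 + 2 * S) / (c * ln 2)).
    by rewrite addr_gt0// divr_gt0 ?mulr_gt0//; lra.
  near=> eps; apply: (rP eps _).2.
  by near: eps.
- by near=> eps; apply: (rP eps _).1; near: eps.
Unshelve. all: by end_near.
Qed.
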